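(* If $E$ is a set with word conditions and $G:=G(E)$, then the category of $E$-twisted rings is equivalent (and even isomorphic) to the category of $G$-rings.
   Context: $W(E)$ is the free monoid of words (finite sequences, including the empty word $1$) on $E$. A set of word conditions on $E$ is a subset $\Gamma\subset W(E)\times W(E)$; a pair $(u,v)\in\Gamma$ is written ''$u=v$'' and called an $E$-condition. $G(E)$ is the quotient monoid of $W(E)$ by the monoid congruence generated by $\Gamma$. An $E$-twisted ring is a (unital, not necessarily commutative) ring $A$ with a family of ring endomorphisms $\sigma_{A,i}$ ($i\in E$) such that $\sigma_{A,i_0}\circ\cdots\circ\sigma_{A,i_{n-1}}=\sigma_{A,j_0}\circ\cdots\circ\sigma_{A,j_{m-1}}$ for every $E$-condition $i_0\cdots i_{n-1}=j_0\cdots j_{m-1}$ (the empty composite being $\mathrm{Id}_A$). A morphism of $E$-twisted rings is a ring homomorphism $\varphi:A\to B$ with $\sigma_{B,i}\circ\varphi=\varphi\circ\sigma_{A,i}$ for all $i\in E$. For a monoid $G$, a $G$-ring is a ring $A$ endowed with an action of $G$ by ring endomorphisms (a monoid morphism from $G$ to the monoid of ring endomorphisms of $A$); a morphism of $G$-rings is a ring homomorphism $\varphi$ with $\varphi(g.x)=g.\varphi(x)$ for all $g\in G$, $x\in A$. *)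

(* Defs.v *)
From HB Require Import structures.
From mathcomp Require Import all_boot all_algebra.
From mathcomp Require Import boolp classical_sets.

Set Implicit Arguments.
Unset Strict Implicit.
Unset Printing Implicit Defensive.

Record category := Category {
  obj :> Type;
  hom : obj -> obj -> Type;
  idm : forall A, hom A A;
  compm : forall A B C, hom B C -> hom A B -> hom A C;
  compm1 : forall A B (f : hom A B), compm f (idm A) = f;
  comp1m : forall A B (f : hom A B), compm (idm B) f = f;
  compmA : forall A B C D (h : hom C D) (g : hom B C) (f : hom A B),
    compm h (compm g f) = compm (compm h g) f
}.

Arguments hom {c} A B.
Arguments idm {c} A.
Arguments compm {c A B C} g f.

Record functor (C D : category) := Functor {
  fobj :> C -> D;
  fmap : forall A B : C, hom A B -> hom (fobj A) (fobj B);
  fmap1 : forall A : C, fmap (idm A) = idm (fobj A);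
  fmapM : forall (A B X : C) (g : hom B X) (f : hom A B),
    fmap (compm g f) = compm (fmap g) (fmap f)
}.

Arguments fmap {C D} F {A B} f : rename.

Definition functor_id (C : category) : functor C C :=
  @Functor C C id (fun _ _ f => f) (fun _ => erefl) (fun _ _ _ _ _ => erefl).

Lemma functor_comp1 (C D X : category) (G : functor D X) (F : functor C D)
  (A : C) : fmap G (fmap F (idm A)) = idm (G (F A)).
Proof. by rewrite !fmap1. Qed.

Lemma functor_compM (C D X : category) (G : functor D X) (F : functor C D)
  (A B Y : C) (g : hom B Y) (f : hom A B) :
  fmap G (fmap F (compm g f)) =
  compm (fmap G (fmap F g)) (fmap G (fmap F f)).
Proof. by rewrite !fmapM. Qed.

Definition functor_comp (C D X : category) (G : functor D X)
    (F : functor C D) : functor C X :=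
  @Functor C X (fun A => G (F A)) (fun _ _ f => fmap G (fmap F f))
    (functor_comp1 G F) (functor_compM G F).

Definition isomorphism (C : category) (A B : C) (f : hom A B) : Prop :=
  exists g : hom B A, compm g f = idm A /\ compm f g = idm B.

Definition naturally_isomorphic (C D : category) (F G : functor C D) : Prop :=
  exists eta : forall A : C, hom (F A) (G A),
    (forall A, isomorphism (eta A)) /\
    (forall (A B : C) (f : hom A B),
       compm (eta B) (fmap F f) = compm (fmap G f) (eta A)).

Definition equivalent_categories (C D : category) : Prop :=
  exists (F : functor C D) (G : functor D C),
    naturally_isomorphic (functor_comp G F) (functor_id C) /\
    naturally_isomorphic (functor_comp F G) (functor_id D).

Definition isomorphic_categories (C D : category) : Prop :=
  exists (F : functor C D) (G : functor D C),
    functor_comp G F = functor_id C /\ functor_comp F G = functor_id D.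

Local Open Scope group_scope.
Local Open Scope quotient_scope.

Definition monoid_congruence (M : monoidType) (r : M -> M -> Prop) : Prop :=
  [/\ forall x, r x x,
      forall x y, r x y -> r y x,
      forall x y z, r x y -> r y z -> r x z
    & forall x y x' y', r x y -> r x' y' -> r (x * x') (y * y')].

Definition generated_congruence (M : monoidType) (Gamma : set (M * M))
    (x y : M) : Prop :=
  forall r : M -> M -> Prop, monoid_congruence r ->
    (forall u v, Gamma (u, v) -> r u v) -> r x y.

Lemma generated_congruenceP (M : monoidType) (Gamma : set (M * M)) :
  monoid_congruence (generated_congruence Gamma).
Proof.
split=> [x|x y xy|x y z xy yz|x y x' y' xy xy'] r cr Gr; case: (cr) => c1 c2 c3 c4.
- exact: c1.
- exact: c2 (xy r cr Gr).
- exact: c3 (xy r cr Gr) (yz r cr Gr).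
- exact: c4 (xy r cr Gr) (xy' r cr Gr).
Qed.

Lemma generated_congruence_sub (M : monoidType) (Gamma : set (M * M)) (u v : M) :
  Gamma (u, v) -> generated_congruence Gamma u v.
Proof. by move=> Guv r _; apply. Qed.

Definition generated_congruenceb (M : monoidType) (Gamma : set (M * M)) : rel M :=
  fun x y => `[< generated_congruence Gamma x y >].

Lemma generated_congruenceb_equiv (M : monoidType) (Gamma : set (M * M)) :
  equiv_class_of (generated_congruenceb Gamma).
Proof.
have [c1 c2 c3 _] := generated_congruenceP Gamma; split.
- by move=> x; apply/asboolP; apply: c1.
- by move=> x y; apply/asboolP/asboolP; apply: c2.
- by move=> y x z /asboolP xy /asboolP yz; apply/asboolP; apply: c3 xy yz.
Qed.

Canonical generated_congruence_equiv (M : monoidType) (Gamma : set (M * M)) :=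
  EquivRelPack (generated_congruenceb_equiv Gamma).

Definition quotient_monoid (M : monoidType) (Gamma : set (M * M)) :=
  {eq_quot generated_congruenceb Gamma}.

HB.instance Definition _ (M : monoidType) (Gamma : set (M * M)) :=
  Choice.on (quotient_monoid Gamma).
HB.instance Definition _ (M : monoidType) (Gamma : set (M * M)) :=
  EqQuotient.on (quotient_monoid Gamma).

Definition quotient_one (M : monoidType) (Gamma : set (M * M)) :
  quotient_monoid Gamma := \pi_(quotient_monoid Gamma) 1.

Definition quotient_mul (M : monoidType) (Gamma : set (M * M))
  (a b : quotient_monoid Gamma) : quotient_monoid Gamma :=
  \pi_(quotient_monoid Gamma) (repr a * repr b).

Lemma quotient_eqP (M : monoidType) (Gamma : set (M * M)) (x y : M) :
  \pi_(quotient_monoid Gamma) x = \pi_(quotient_monoid Gamma) y <->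
  generated_congruence Gamma x y.
Proof.
by split=> [/eqmodP/asboolP //|xy]; apply/eqmodP/asboolP.
Qed.

Lemma quotient_mulE (M : monoidType) (Gamma : set (M * M)) (x y : M) :
  quotient_mul (\pi_(quotient_monoid Gamma) x)
    (\pi_(quotient_monoid Gamma) y) =
  \pi_(quotient_monoid Gamma) (x * y).
Proof.
have [_ _ _ cM] := generated_congruenceP Gamma.
by apply/quotient_eqP; apply: cM; apply/quotient_eqP; rewrite reprK.
Qed.

Lemma quotient_mulA (M : monoidType) (Gamma : set (M * M)) :
  associative (@quotient_mul M Gamma).
Proof.
elim/quotW=> a; elim/quotW=> b; elim/quotW=> c.
by rewrite (quotient_mulE Gamma b c) (quotient_mulE Gamma a b) !quotient_mulE mulgA.
Qed.

Lemma quotient_mul1g (M : monoidType) (Gamma : set (M * M)) :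
  left_id (quotient_one Gamma) (@quotient_mul M Gamma).
Proof. by elim/quotW=> a; rewrite quotient_mulE mul1g. Qed.

Lemma quotient_mulg1 (M : monoidType) (Gamma : set (M * M)) :
  right_id (quotient_one Gamma) (@quotient_mul M Gamma).
Proof. by elim/quotW=> a; rewrite quotient_mulE mulg1. Qed.

HB.instance Definition _ (M : monoidType) (Gamma : set (M * M)) :=
  isMonoid.Build (quotient_monoid Gamma)
    (@quotient_mulA M Gamma) (@quotient_mul1g M Gamma) (@quotient_mulg1 M Gamma).

Definition word (E : Type) : Type := seq E.

(* [E] is an arbitrary type; [monoidType] asks for a choice structure, which is
   taken from the classical axioms. *)
HB.instance Definition _ (E : Type) := gen_eqMixin (word E).
HB.instance Definition _ (E : Type) := gen_choiceMixin (word E).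
HB.instance Definition _ (E : Type) :=
  isMonoid.Build (word E) (@catA E) (@cat0s E) (@cats0 E).

Definition word_conditions (E : Type) := set (word E * word E).

Definition word_monoid (E : Type) (Gamma : word_conditions E) : monoidType :=
  quotient_monoid Gamma.

Definition ring_end (A : pzRingType) : Type := {rmorphism A -> A}.

Definition ring_end_one (A : pzRingType) : ring_end A :=
  (idfun : {rmorphism A -> A}).

Definition ring_end_mul (A : pzRingType) (f g : ring_end A) : ring_end A :=
  ((f : {rmorphism A -> A}) \o (g : {rmorphism A -> A}) : {rmorphism A -> A}).

Lemma rmorphism_ext (A B : pzRingType) (f g : {rmorphism A -> B}) :
  f =1 g -> f = g.
Proof.
case: f g => [f [[fB] [fM]]] [g [[gB] [gM]]] /= fg.
have efg : f = g by apply: funext.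
case: g / efg gB gM {fg} => gB gM.
by rewrite (Prop_irrelevance fB gB) (Prop_irrelevance fM gM).
Qed.

Lemma ring_end_mulA (A : pzRingType) : associative (@ring_end_mul A).
Proof. by move=> f g h; apply: rmorphism_ext. Qed.

Lemma ring_end_mul1g (A : pzRingType) :
  left_id (ring_end_one A) (@ring_end_mul A).
Proof. by move=> f; apply: rmorphism_ext. Qed.

Lemma ring_end_mulg1 (A : pzRingType) :
  right_id (ring_end_one A) (@ring_end_mul A).
Proof. by move=> f; apply: rmorphism_ext. Qed.

HB.instance Definition _ (A : pzRingType) := gen_eqMixin (ring_end A).
HB.instance Definition _ (A : pzRingType) := gen_choiceMixin (ring_end A).
HB.instance Definition _ (A : pzRingType) :=
  isMonoid.Build (ring_end A)
    (@ring_end_mulA A) (@ring_end_mul1g A) (@ring_end_mulg1 A).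

(* [pzRingType] rather than [nzRingType]: the zero ring is a unital ring.
   In [ring_end], the product of a word is the composite of its letters in the
   same order (the first letter is applied last) and the empty product is the
   identity. *)
Record twisted_ring (E : Type) (Gamma : word_conditions E) := TwistedRing {
  tring :> pzRingType;
  tsigma : E -> {rmorphism tring -> tring};
  tcond : forall u v : word E, Gamma (u, v) ->
    \prod_(i <- u) (tsigma i : ring_end tring) =
    \prod_(i <- v) (tsigma i : ring_end tring)
}.

Arguments tsigma {E Gamma} A i : rename.

Record twisted_hom (E : Type) (Gamma : word_conditions E)
    (A B : twisted_ring Gamma) := TwistedHom {
  thom :> {rmorphism A -> B};
  thom_comm : forall i, tsigma B i \o thom =1 thom \o tsigma A i
}.

Lemma twisted_hom_ext (E : Type) (Gamma : word_conditions E)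
  (A B : twisted_ring Gamma) (f g : twisted_hom A B) : f =1 g -> f = g.
Proof.
case: f g => [f fP] [g gP] /= /rmorphism_ext efg.
by case: g / efg gP => gP; rewrite (Prop_irrelevance fP gP).
Qed.

Definition twisted_id (E : Type) (Gamma : word_conditions E)
    (A : twisted_ring Gamma) : twisted_hom A A :=
  @TwistedHom E Gamma A A idfun (fun _ _ => erefl).

Lemma twisted_comp_comm (E : Type) (Gamma : word_conditions E)
  (A B C : twisted_ring Gamma) (g : twisted_hom B C) (f : twisted_hom A B) i :
  tsigma C i \o (g \o f) =1 (g \o f) \o tsigma A i.
Proof.
move=> x /=; have /= -> := thom_comm g i (f x).
by congr (g _); apply: (thom_comm f i x).
Qed.

Definition twisted_comp (E : Type) (Gamma : word_conditions E)
    (A B C : twisted_ring Gamma) (g : twisted_hom B C) (f : twisted_hom A B) :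
    twisted_hom A C :=
  @TwistedHom E Gamma A C (g \o f) (twisted_comp_comm g f).

Definition twisted_rings (E : Type) (Gamma : word_conditions E) : category.
Proof.
refine (@Category (twisted_ring Gamma) (@twisted_hom E Gamma)
  (@twisted_id E Gamma) (@twisted_comp E Gamma) _ _ _);
by move=> *; apply: twisted_hom_ext.
Defined.

Record acted_ring (G : monoidType) := ActedRing {
  aring :> pzRingType;
  action : UMagmaMorphism.type G (ring_end aring)
}.

Definition act (G : monoidType) (A : acted_ring G) (g : G) :
    {rmorphism A -> A} := action A g.

Record acted_hom (G : monoidType) (A B : acted_ring G) := ActedHom {
  ahom :> {rmorphism A -> B};
  ahom_act : forall (g : G) (x : A), ahom (act A g x) = act B g (ahom x)
}.

Lemma acted_hom_ext (G : monoidType) (A B : acted_ring G)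
  (f g : acted_hom A B) : f =1 g -> f = g.
Proof.
case: f g => [f fP] [g gP] /= /rmorphism_ext efg.
by case: g / efg gP => gP; rewrite (Prop_irrelevance fP gP).
Qed.

Definition acted_id (G : monoidType) (A : acted_ring G) : acted_hom A A :=
  @ActedHom G A A idfun (fun _ _ => erefl).

Lemma acted_comp_act (G : monoidType) (A B C : acted_ring G)
  (p : acted_hom B C) (f : acted_hom A B) (g : G) (x : A) :
  (p \o f) (act A g x) = act C g ((p \o f) x).
Proof. by rewrite /= !ahom_act. Qed.

Definition acted_comp (G : monoidType) (A B C : acted_ring G)
    (p : acted_hom B C) (f : acted_hom A B) : acted_hom A C :=
  @ActedHom G A C (p \o f) (acted_comp_act p f).

Definition acted_rings (G : monoidType) : category.
Proof.
refine (@Category (acted_ring G) (@acted_hom G)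
  (@acted_id G) (@acted_comp G) _ _ _);
by move=> *; apply: acted_hom_ext.
Defined.

(* Main.v *)
From HB Require Import structures.
From mathcomp Require Import all_boot all_algebra.
From mathcomp Require Import boolp classical_sets.
Require Import Defs.

(** The monoid G(E) is presented by the generators E and the relations Gamma,
    so a monoid morphism from G(E) to a monoid M is the same thing as a family
    of elements of M indexed by E whose products satisfy the word conditions.
    Taking for M the monoid of ring endomorphisms of A, an E-twisted structure
    on A is the same thing as an action of G(E) on A ([presented_lift] in one
    direction, restriction to the generators in the other).  A ring morphism
    that commutes with the generators commutes with every product of
    generators, hence with all of G(E), because every class is the product of
    the generators along a representing word ([presented_morphE]).

    The two resulting functors are mutually inverse and do not touch the
    underlying rings and maps.  Equality of functors is nevertheless equality
    of dependent data: the morphism parts can only be compared once the object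
    parts have been identified.  This is handled by turning an equality of
    objects into a morphism ([eq_hom]): functors that agree on objects and form
    commuting squares with these morphisms are equal ([functor_ext]).  Here all
    the [eq_hom] occurring are identity maps of the underlying ring, so the
    squares commute trivially.  Equivalence of the categories then follows from
    their isomorphism, equal functors being naturally isomorphic. *)

Set Implicit Arguments.
Unset Strict Implicit.
Unset Printing Implicit Defensive.

Local Open Scope group_scope.
Local Open Scope quotient_scope.

(** * Equality of functors *)

Definition eq_hom (C : category) (A B : C) (e : A = B) : hom A B :=
  ecast X (hom A X) e (idm A).

(** The squares replace a transport of [fmap F f] along [e]: this keeps the
    comparison of morphisms inside D, where the two sides have the same type. *)
Lemma functor_ext (C D : category) (F G : functor C D)
    (e : forall A, F A = G A) :
  (forall (A B : C) (f : hom A B),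
     compm (eq_hom (e B)) (fmap F f) = compm (fmap G f) (eq_hom (e A))) ->
  F = G.
Proof.
case: F G e => [F fF F1 FM] [G fG G1 GM] /= e.
have eFG : F = G by apply: funext.
(* Once the object maps are identified, each [e A] is a proof of [F A = F A],
   so that [eq_hom (e A)] is an identity and the squares say [fF = fG]. *)
case: G / eFG e fG G1 GM => e fG G1 GM sq.
have efG : fF = fG.
  apply: functional_extensionality_dep => A.
  apply: functional_extensionality_dep => B; apply: funext => f.
  have := sq A B f.
  by rewrite (Prop_irrelevance (e A) erefl) (Prop_irrelevance (e B) erefl)
             comp1m compm1.
case: fG / efG G1 GM {sq} => G1 GM.
by rewrite (Prop_irrelevance F1 G1) (Prop_irrelevance FM GM).
Qed.

Lemma naturally_isomorphic_refl (C D : category) (F : functor C D) :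
  naturally_isomorphic F F.
Proof.
exists (fun A => idm (F A)); split=> [A|A B f].
  by exists (idm (F A)); rewrite comp1m.
by rewrite comp1m compm1.
Qed.

Lemma isomorphic_equivalent (C D : category) :
  isomorphic_categories C D -> equivalent_categories C D.
Proof.
case=> F [G [GF FG]]; exists F, G.
by rewrite GF FG; split; apply: naturally_isomorphic_refl.
Qed.

(** * The universal property of a presented monoid *)

Lemma umagma_morphism_ext (G H : monoidType) (f g : UMagmaMorphism.type G H) :
  f =1 g -> f = g.
Proof.
case: f g => [f [[f1] [fM]]] [g [[g1] [gM]]] /= fg.
have efg : f = g by apply: funext.
case: g / efg g1 gM {fg} => g1 gM.
by rewrite (Prop_irrelevance f1 g1) (Prop_irrelevance fM gM).
Qed.

Section Presentation.
Variables (E : Type) (Gamma : word_conditions E) (M : monoidType).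

Definition generator (i : E) : word_monoid Gamma :=
  \pi_(quotient_monoid Gamma) ([:: i] : word E).

Lemma prod_generator (u : word E) :
  \prod_(i <- u) generator i = \pi_(quotient_monoid Gamma) u.
Proof.
elim: u => [|i u IHu]; first by rewrite big_nil.
by rewrite big_cons IHu; apply: (quotient_mulE Gamma [:: i] u).
Qed.

Lemma presented_morph_pi (f : UMagmaMorphism.type (word_monoid Gamma) M)
    (u : word E) :
  \prod_(i <- u) f (generator i) = f (\pi_(quotient_monoid Gamma) u).
Proof.
by rewrite -prod_generator (big_morph f gmulfM gmulf1).
Qed.

Lemma presented_morphE (f : UMagmaMorphism.type (word_monoid Gamma) M)
    (q : word_monoid Gamma) :
  f q = \prod_(i <- (repr q : word E)) f (generator i).
Proof. by rewrite presented_morph_pi reprK. Qed.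

(** The two sides of a condition are the same element of the presented monoid,
    so [f] cannot distinguish them. *)
Lemma presented_morph_cond (f : UMagmaMorphism.type (word_monoid Gamma) M)
    (u v : word E) : Gamma (u, v) ->
  \prod_(i <- u) f (generator i) = \prod_(i <- v) f (generator i).
Proof.
move=> /generated_congruence_sub/quotient_eqP uv.
by rewrite !presented_morph_pi uv.
Qed.

Section Lift.
Variable s : E -> M.
Hypothesis s_cond : forall u v : word E, Gamma (u, v) ->
  \prod_(i <- u) s i = \prod_(i <- v) s i.

(** Having the same value under [s] is a congruence on words; it contains
    Gamma, hence the congruence that Gamma generates. *)
Lemma presented_prod_eq (u v : word E) : generated_congruence Gamma u v ->
  \prod_(i <- u) s i = \prod_(i <- v) s i.
Proof.
move=> uv.
apply: (uv (fun u v => \prod_(i <- u) s i = \prod_(i <- v) s i)) => //.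
split=> [//|x y -> //|x y z -> //|x y x' y' xy xy'].
by rewrite !big_cat xy xy'.
Qed.

(** The chosen representative is immaterial, by [presented_lift_pi]. *)
Definition presented_lift_fun (q : word_monoid Gamma) : M :=
  \prod_(i <- (repr q : word E)) s i.

Lemma presented_lift_pi (u : word E) :
  presented_lift_fun (\pi_(quotient_monoid Gamma) u) = \prod_(i <- u) s i.
Proof. by apply: presented_prod_eq; apply/quotient_eqP; rewrite reprK. Qed.

Lemma presented_lift1 : presented_lift_fun 1 = 1.
Proof. by rewrite (presented_lift_pi [::]) big_nil. Qed.

Lemma presented_liftM : {morph presented_lift_fun : p q / p * q}.
Proof.
move=> p q.
by rewrite (presented_lift_pi ((repr p : word E) ++ (repr q : word E))) big_cat.
Qed.

HB.instance Definition _ :=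
  isUMagmaMorphism.Build (word_monoid Gamma) M presented_lift_fun
    (presented_lift1, presented_liftM).

Definition presented_lift : UMagmaMorphism.type (word_monoid Gamma) M :=
  presented_lift_fun.

Lemma presented_lift_generator i : presented_lift (generator i) = s i.
Proof. by rewrite /presented_lift /= presented_lift_pi big_seq1. Qed.

End Lift.

End Presentation.

(** * Twisted rings and rings with an action *)

Section Isomorphism.
Variables (E : Type) (Gamma : word_conditions E).

Let G : monoidType := word_monoid Gamma.

Definition twisted_action (A : twisted_ring Gamma) : acted_ring G :=
  ActedRing
    (presented_lift (M := ring_end A) (s := tsigma A) (@tcond _ _ A)).

Definition acted_twist (B : acted_ring G) : twisted_ring Gamma :=
  @TwistedRing E Gamma B (fun i => action B (generator Gamma i))
    (presented_morph_cond (action B)).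

(** The letters of a word are applied one after the other, and [f] can be moved
    past each of them in turn. *)
Lemma prod_ring_end_commute (A B : pzRingType) (s : E -> ring_end A)
    (t : E -> ring_end B) (f : A -> B) :
  (forall i x, f ((s i : {rmorphism A -> A}) x) =
               (t i : {rmorphism B -> B}) (f x)) ->
  forall (u : word E) (x : A),
    f ((\prod_(i <- u) s i : {rmorphism A -> A}) x) =
    (\prod_(i <- u) t i : {rmorphism B -> B}) (f x).
Proof.
move=> fst; elim=> [|i u IHu] x; first by rewrite !big_nil.
by rewrite !big_cons /= fst IHu.
Qed.

Lemma twisted_hom_act (A B : twisted_ring Gamma) (f : twisted_hom A B)
    (q : G) (x : A) :
  f (act (twisted_action A) q x) = act (twisted_action B) q (f x).
Proof.
apply: prod_ring_end_commute => i y.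
exact/esym/(thom_comm f i y).
Qed.

Definition twisted_to_acted : functor (twisted_rings Gamma) (acted_rings G).
Proof.
refine (@Functor (twisted_rings Gamma) (acted_rings G) twisted_action
  (fun A B f => @ActedHom G (twisted_action A) (twisted_action B) (thom f)
    (twisted_hom_act f)) _ _).
- by move=> A; apply: acted_hom_ext.
- by move=> A B X g f; apply: acted_hom_ext.
Defined.

Lemma acted_hom_comm (A B : acted_ring G) (f : acted_hom A B) i :
  tsigma (acted_twist B) i \o f =1 f \o tsigma (acted_twist A) i.
Proof. by move=> x; apply/esym/(ahom_act f (generator Gamma i) x). Qed.

Definition acted_to_twisted : functor (acted_rings G) (twisted_rings Gamma).
Proof.
refine (@Functor (acted_rings G) (twisted_rings Gamma) acted_twist
  (fun A B f => @TwistedHom E Gamma (acted_twist A) (acted_twist B) (ahom f)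
    (acted_hom_comm f)) _ _).
- by move=> A; apply: twisted_hom_ext.
- by move=> A B X g f; apply: twisted_hom_ext.
Defined.

Lemma twisted_ring_eq (A : twisted_ring Gamma) (s : E -> {rmorphism A -> A}) c :
  s = tsigma A -> @TwistedRing E Gamma A s c = A.
Proof.
case: A s c => A t d /= s c est; case: t / est d => d.
by rewrite (Prop_irrelevance c d).
Qed.

Lemma acted_ring_eq (B : acted_ring G)
    (a : UMagmaMorphism.type G (ring_end B)) :
  a = action B -> ActedRing a = B.
Proof. by case: B a => B b /= a ->. Qed.

Lemma twisted_actionK (A : twisted_ring Gamma) :
  acted_twist (twisted_action A) = A.
Proof.
apply: twisted_ring_eq; apply: funext => i.
exact: (presented_lift_generator (M := ring_end A) (@tcond _ _ A)).
Qed.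

Lemma acted_twistK (B : acted_ring G) : twisted_action (acted_twist B) = B.
Proof.
apply: acted_ring_eq; apply: umagma_morphism_ext => q.
exact/esym/presented_morphE.
Qed.

Lemma twisted_eq_homE (A B : twisted_rings Gamma) (e : A = B) (x : tring A) :
  thom (eq_hom e) x =
  ecast R (R : pzRingType) (congr1 (@tring E Gamma) e) x.
Proof. by case: B / e. Qed.

(** An equality between two structures on one ring projects to an equality of
    that ring with itself, and any such equality is reflexivity: the transport
    is the identity map. *)
Lemma twisted_eq_hom_id (A : twisted_ring Gamma)
    (s : E -> {rmorphism A -> A}) c
    (e : @TwistedRing E Gamma A s c = A :> twisted_rings Gamma) (x : A) :
  thom (eq_hom e) x = x.
Proof.
rewrite twisted_eq_homE.
by rewrite (Prop_irrelevance (congr1 _ e) (erefl (tring A))).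
Qed.

Lemma acted_eq_homE (A B : acted_rings G) (e : A = B) (x : aring A) :
  ahom (eq_hom e) x = ecast R (R : pzRingType) (congr1 (@aring G) e) x.
Proof. by case: B / e. Qed.

Lemma acted_eq_hom_id (B : acted_ring G)
    (a : UMagmaMorphism.type G (ring_end B))
    (e : ActedRing a = B :> acted_rings G) (x : B) :
  ahom (eq_hom e) x = x.
Proof.
rewrite acted_eq_homE.
by rewrite (Prop_irrelevance (congr1 _ e) (erefl (aring B))).
Qed.

Lemma twisted_to_actedK :
  functor_comp acted_to_twisted twisted_to_acted =
  functor_id (twisted_rings Gamma).
Proof.
apply: (@functor_ext _ _ (functor_comp acted_to_twisted twisted_to_acted)
  (functor_id (twisted_rings Gamma)) twisted_actionK) => A B f.
apply: twisted_hom_ext => x /=.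
by rewrite !twisted_eq_hom_id.
Qed.

Lemma acted_to_twistedK :
  functor_comp twisted_to_acted acted_to_twisted = functor_id (acted_rings G).
Proof.
apply: (@functor_ext _ _ (functor_comp twisted_to_acted acted_to_twisted)
  (functor_id (acted_rings G)) acted_twistK) => A B f.
apply: acted_hom_ext => x /=.
by rewrite !acted_eq_hom_id.
Qed.

End Isomorphism.

Theorem proposition2p2 (E : Type) (Gamma : word_conditions E) :
  equivalent_categories (twisted_rings Gamma) (acted_rings (word_monoid Gamma)) /\
  isomorphic_categories (twisted_rings Gamma) (acted_rings (word_monoid Gamma)).
Proof.
have iso : isomorphic_categories (twisted_rings Gamma)
    (acted_rings (word_monoid Gamma)).
  exists (twisted_to_acted Gamma), (acted_to_twisted Gamma).
  by split; [apply: twisted_to_actedK | apply: acted_to_twistedK].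
by split=> //; apply: isomorphic_equivalent.
Qed.
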